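(* Suppose that the finite groups $G$ and $G'$ of order $v$ both possess partial difference sets of Paley type, that is, with parameters $\left(v,\frac{v-1}{2},\frac{v-5}{4},\frac{v-1}{4}\right)$. Then the group $G\times G'$ also contains a Paley-type partial difference set, with parameters $\left(v^2,\frac{v^2-1}{2},\frac{v^2-5}{4},\frac{v^2-1}{4}\right)$.
   Context: A $(v,k,\lambda,\mu)$-partial difference set (PDS) in a finite group $G$ (not necessarily abelian) of order $v$ is a subset $D$ with $|D|=k$ such that every nonidentity element of $D$ can be written as $d_1d_2^{-1}$ with $d_1,d_2\in D$ in exactly $\lambda$ ways, and every nonidentity element of $G-D$ in exactly $\mu$ ways. PDSs are assumed regular: $1_G\notin D$ and $D=D^{-1}$. *)

(* Defs.v *)
From mathcomp Require Import all_boot all_order all_fingroup all_algebra.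

Set Implicit Arguments.
Unset Strict Implicit.
Unset Printing Implicit Defensive.

Import GRing.Theory.

Local Open Scope group_scope.

Definition diff_count (gT : finGroupType) (D : {set gT}) (g : gT) : nat :=
  #|[set d in setX D D | d.1 * d.2^-1 == g]|.

(* The parameters k, l (lambda) and m (mu) are rationals, so that a fraction
   such as (v - 5) / 4 is exact instead of a truncated quotient. The counts
   are naturals, so a fractional value is never attained.
   In the last condition, D^-1 is the set of the inverses of the elements
   of D. *)
Definition is_pds (gT : finGroupType) (G : {group gT}) (D : {set gT})
    (v : nat) (k l m : rat) : Prop :=
  [/\ #|G| = v,
      D \subset G,
      (#|D|%:R = k)%R,
      (forall g, g \in D -> g != 1 -> ((diff_count D g)%:R = l)%R) &
      (forall g, g \in G :\: D -> g != 1 -> ((diff_count D g)%:R = m)%R)]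
  /\ 1 \notin D /\ D^-1 = D.

Definition is_paley_pds (gT : finGroupType) (G : {group gT}) (D : {set gT})
    (v : nat) : Prop :=
  is_pds G D v ((v%:R - 1) / 2%:R)%R ((v%:R - 5%:R) / 4%:R)%R
    ((v%:R - 1) / 4%:R)%R.

(* Main.v *)
Require Import Defs.
From mathcomp Require Import all_boot all_order all_fingroup all_algebra.
From mathcomp Require Import ring lra.

(** The proof trades a difference set [D] for its sign function [chi], which
    is [0] at the identity, [1] on [D] and [-1] elsewhere.  Write [delta] for
    the indicator of the identity and [J] for the constant function [1] on a
    group of order [v].  Expanding [chi = 2 1_D - J + delta] shows that an
    inverse-closed [D] avoiding the identity is of Paley type exactly when
    [chi] has sum [0] and autocorrelation [v delta - J] ([paley_pdsP]); in
    matrix terms, [chi] develops into a symmetric matrix [S] with zero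
    diagonal, [S J = 0] and [S S^T = v I - J].

    In this language the product construction is one formula:
      [X = chi (x) chi' + delta (x) J' - J (x) delta'].
    It is again [0] at the identity and [1] or [-1] elsewhere, so it is the
    sign function of some set ([paley_sign_prod]).  In its autocorrelation
    the cross terms with [chi (x) chi'] vanish, because each of them has the
    sum of [chi] or of [chi'] as a factor, and what remains is
      [(v delta - J)(v delta' - J') + v delta J' + v J delta' - 2 J J'
         = v^2 delta delta' - J J']
    ([paley_pds_prod]). *)

Set Implicit Arguments.
Unset Strict Implicit.
Unset Printing Implicit Defensive.

Import GRing.Theory.

Section PaleyProduct.

Local Open Scope ring_scope.

Section Sums.

Variables (gT gT' : finGroupType) (G : {group gT}) (G' : {group gT'}).

Lemma sum_translate (f : gT -> rat) g : g \in G ->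
  \sum_(b in G) f (g * b)%g = \sum_(b in G) f b.
Proof.
move=> gG; rewrite [RHS](reindex_inj (mulgI g)) /=.
by apply: eq_bigl => b; rewrite groupMl.
Qed.

Lemma sum_delta (f : gT -> rat) a : a \in G ->
  \sum_(b in G) f b * (b == a)%:R = f a.
Proof.
move=> aG; rewrite (bigD1 a) //= eqxx mulr1 big1 ?addr0 // => b /andP[_ ne].
by rewrite (negPf ne) mulr0.
Qed.

Lemma sum_delta1 : \sum_(b in G) (b == 1%g)%:R = 1 :> rat.
Proof.
rewrite -[RHS](sum_delta (fun=> 1) (group1 G)).
by apply: eq_bigr => b _; rewrite mul1r.
Qed.

Lemma sum_mem (D : {set gT}) : D \subset G ->
  \sum_(b in G) (b \in D)%:R = #|D|%:R :> rat.
Proof.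
move=> sDG; rewrite -sum1_card natr_sum big_mkcond /= [RHS]big_mkcond /=.
apply: eq_bigr => b _; case: (boolP (b \in D)) => [bD | _]; last by case: ifP.
by rewrite (subsetP sDG).
Qed.

Lemma sum_setX_mul (f : gT -> rat) (f' : gT' -> rat) :
  \sum_(z in setX G G') f z.1 * f' z.2
    = (\sum_(b in G) f b) * (\sum_(b in G') f' b).
Proof.
rewrite mulr_suml; under [RHS]eq_bigr do rewrite mulr_sumr.
rewrite pair_big /=; apply: eq_bigl => z; by rewrite inE.
Qed.

Lemma diff_count_sum (D : {set gT}) g : D \subset G -> g \in G ->
  (diff_count D g)%:R
    = \sum_(b in G) (g * b \in D)%g%:R * (b \in D)%:R :> rat.
Proof.
move=> sDG gG; pose B := [set b in D | (g * b)%g \in D].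
have sBG : B \subset G.
  by apply/subsetP=> b; rewrite inE => /andP[/(subsetP sDG)].
transitivity (#|B|%:R : rat); last first.
  rewrite -(sum_mem sBG); apply: eq_bigr => b _; rewrite inE.
  by case: (b \in D); case: (_ \in D); rewrite ?mulr1 ?mulr0.
congr _%:R; rewrite /diff_count.
rewrite -(card_imset B (f := fun b => ((g * b)%g, b))); last by move=> b c [].
apply: eq_card => -[a b]; rewrite !inE /=; apply/idP/imsetP.
  case/andP=> /andP[aD bD] /eqP eg.
  have ea : (g * b)%g = a by rewrite -eg mulgVK.
  by exists b; rewrite ?inE ea ?bD.
by case=> c; rewrite inE => /andP[cD gcD] [-> ->]; rewrite gcD cD mulgK eqxx.
Qed.

End Sums.

Section Sign.

Variables (gT : finGroupType) (G : {group gT}) (D : {set gT}).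

(** When [1] is outside [D] this is [0] at [1], [1] on [D] and [-1] elsewhere;
    the linear form makes sums expand without case analysis. *)
Definition paley_sign (x : gT) : rat := 2%:R * (x \in D)%:R - 1 + (x == 1%g)%:R.

Hypotheses (sDG : D \subset G) (D1 : 1%g \notin D) (DV : (D^-1)%g = D).

Lemma sum_paley_sign :
  \sum_(b in G) paley_sign b = 2%:R * #|D|%:R - #|G|%:R + 1.
Proof.
rewrite big_split /= sumrB -mulr_sumr (sum_mem sDG) sumr_const.
by rewrite sum_delta1.
Qed.

(** Both cross terms of [1_D] with [delta] evaluate to [1_D g], one of them
    through [D^-1 = D]; this produces the coefficient [4], which separates
    the values of [lambda] and [mu] by exactly [1]. *)
Lemma paley_sign_corr g : g \in G ->
  \sum_(b in G) paley_sign (g * b)%g * paley_sign b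
    = 4%:R * (diff_count D g)%:R - 4%:R * #|D|%:R + #|G|%:R - 2%:R
      + 4%:R * (g \in D)%:R + (g == 1%g)%:R.
Proof.
move=> gG.
pose d b : rat := (b \in D)%:R.
have gVG : g^-1%g \in G by rewrite groupV.
have dV : d g^-1%g = d g by rewrite /d -mem_invg DV.
have eqV b : ((g * b)%g == 1%g) = (b == g^-1%g).
  by rewrite -(inj_eq (mulgI g) b) mulgV.
transitivity (\sum_(b in G) (4%:R * (d (g * b)%g * d b)
   + (- 2%:R * d (g * b)%g - 2%:R * d b + 1
   + ((2%:R * d (g * b)%g - 1 + (b == g^-1%g)%:R) * (b == 1%g)%:R
      + (2%:R * d b - 1) * (b == g^-1%g)%:R)))).
  apply: eq_bigr => b _; rewrite /paley_sign eqV -/(d _) -/(d b); ring.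
rewrite !big_split /= -!mulr_sumr -diff_count_sum //.
rewrite (sum_translate d gG) sumrN -mulr_sumr (sum_mem sDG) sumr_const.
rewrite (sum_delta (fun b => 2%:R * d (g * b)%g - 1 + (b == g^-1%g)%:R)) //.
rewrite (sum_delta (fun b => 2%:R * d b - 1)) // mulg1 dV eq_sym invg_eq1.
rewrite /d; ring.
Qed.

End Sign.

(** Away from [1] the autocorrelation is affine in [diff_count D g], so each
    condition on one side is a condition on the other.  At [1] it is the
    sum of the squares of the values of the sign function, hence always
    [v - 1]. *)
Lemma paley_pdsP (gT : finGroupType) (G : {group gT}) (D : {set gT}) v :
  is_paley_pds G D v <->
  [/\ #|G| = v, D \subset G, 1%g \notin D, (D^-1)%g = D &
      \sum_(b in G) paley_sign D b = 0 /\
      forall g, g \in G -> \sum_(b in G) paley_sign D (g * b)%g * paley_sign D b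
        = v%:R * (g == 1%g)%:R - 1].
Proof.
split.
  case=> -[cG sDG cD lamD muD] [D1 DV]; split=> //; split.
    by rewrite (sum_paley_sign sDG) cG cD; field.
  move=> g gG; rewrite paley_sign_corr // cG cD.
  have [-> | g1] := eqVneq g 1%g.
    rewrite (diff_count_sum sDG) // (negPf D1).
    under eq_bigr do rewrite mul1g -natrM mulnb andbb.
    by rewrite (sum_mem sDG) cD /=; field.
  case: (boolP (g \in D)) => gD /=.
    by rewrite lamD //; field.
  by rewrite muD ?inE ?gD //; field.
case=> cG sDG D1 DV [sum0 corr].
have cD : #|D|%:R = (v%:R - 1) / 2%:R :> rat.
  by move: sum0; rewrite (sum_paley_sign sDG) cG => sum0; lra.
split=> //; split=> // g.
  move=> gD g1; have gG := subsetP sDG g gD.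
  move: (corr g gG); rewrite paley_sign_corr // cG cD gD (negPf g1) /=; lra.
case/setDP=> gG gD g1.
move: (corr g gG); rewrite paley_sign_corr // cG cD (negPf gD) (negPf g1) /=.
lra.
Qed.

Section Product.

Variables (gT gT' : finGroupType) (G : {group gT}) (G' : {group gT'}).
Variables (D : {set gT}) (D' : {set gT'}).

Definition paley_prod : {set gT * gT'} :=
  [set z in setX G G' | (z.2 != 1%g) &&
     ((z.1 == 1%g) || ((z.1 \in D) == (z.2 \in D')))].

Hypotheses (D1 : 1%g \notin D) (D'1 : 1%g \notin D').

(** The two indicators enter with opposite signs, so they cancel at the
    identity, and also when summed over a product of two groups of equal
    order. *)
Lemma paley_sign_prod z : z \in setX G G' ->
  paley_sign paley_prod z
    = paley_sign D z.1 * paley_sign D' z.2 + (z.1 == 1%g)%:R - (z.2 == 1%g)%:R.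
Proof.
case: z => x y zG.
have -> : paley_sign paley_prod (x, y) = 2%:R * ((x, y) \in paley_prod)%:R - 1
    + ((x == 1%g) && (y == 1%g))%:R by [].
rewrite /paley_sign inE zG /=.
case: (eqVneq x 1%g) => [-> | _]; case: (eqVneq y 1%g) => [-> | _];
  rewrite ?(negPf D1) ?(negPf D'1) /=; try ring;
  by case: (x \in D); case: (y \in D') => /=; ring.
Qed.

End Product.

Lemma paley_pds_prod v (gT gT' : finGroupType)
    (G : {group gT}) (G' : {group gT'}) (D : {set gT}) (D' : {set gT'}) :
  is_paley_pds G D v -> is_paley_pds G' D' v ->
  is_paley_pds (setX_group G G') (paley_prod G G' D D') (v ^ 2)%N.
Proof.
case/paley_pdsP=> cG sDG D1 DV [s0 corr].
case/paley_pdsP=> cG' sDG' D'1 DV' [s0' corr'].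
apply/paley_pdsP.
pose c := paley_sign D; pose c' := paley_sign D'.
pose e (x : gT) : rat := (x == 1%g)%:R.
pose e' (x : gT') : rat := (x == 1%g)%:R.
pose j (x : gT) : rat := 1; pose j' (x : gT') : rat := 1.
have sj : \sum_(b in G) j b = v%:R by rewrite sumr_const cG.
have sj' : \sum_(b in G') j' b = v%:R by rewrite sumr_const cG'.
have se : \sum_(b in G) e b = 1 := sum_delta1 G.
have se' : \sum_(b in G') e' b = 1 := sum_delta1 G'.
split.
- by rewrite cardsX cG cG' mulnn.
- by apply/subsetP=> z; rewrite inE => /andP[].
- by rewrite inE /= eqxx andbF.
- apply/setP=> -[x y]; rewrite inE !inE /= !groupV !invg_eq1.
  by rewrite -[x^-1%g \in D]mem_invg -[y^-1%g \in D']mem_invg DV DV'.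
split.
  transitivity (\sum_(z in setX G G')
      (c z.1 * c' z.2 + e z.1 * j' z.2 - j z.1 * e' z.2)).
    by apply: eq_bigr => z zG; rewrite paley_sign_prod // mulr1 mul1r.
  rewrite sumrB big_split /= !sum_setX_mul s0 se sj se' sj'; ring.
move=> [g g'] zG; have := zG; rewrite inE /= => /andP[gG gG'].
pose cg b := c (g * b)%g; pose cg' b := c' (g' * b)%g.
pose eg b := e (g * b)%g; pose eg' b := e' (g' * b)%g.
(* Each of the nine terms of the expanded square is a function of the first
   coordinate times one of the second.  Naming these functions turns the sum
   of each term into an instance of [sum_setX_mul]. *)
pose cc b := cg b * c b; pose ce b := cg b * e b.
pose ec b := eg b * c b; pose ee b := eg b * e b.
pose cc' b := cg' b * c' b; pose ce' b := cg' b * e' b.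
pose ec' b := eg' b * c' b; pose ee' b := eg' b * e' b.
transitivity (\sum_(z in setX G G')
   (cc z.1 * cc' z.2 + ce z.1 * cg' z.2 - cg z.1 * ce' z.2
    + ec z.1 * c' z.2 + ee z.1 * j' z.2 - eg z.1 * e' z.2
    - c z.1 * ec' z.2 - e z.1 * eg' z.2 + j z.1 * ee' z.2)).
  apply: eq_bigr => z zG'; rewrite !paley_sign_prod ?groupM //=.
  rewrite /cc /ce /ec /ee /cc' /ce' /ec' /ee' /cg /cg' /eg /eg' /j /j'.
  rewrite /c /c' /e /e'; ring.
rewrite !(sumrB, big_split) /= !sum_setX_mul.
have scg : \sum_(b in G) cg b = 0 by rewrite (sum_translate c gG).
have scg' : \sum_(b in G') cg' b = 0 by rewrite (sum_translate c' gG').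
have seg : \sum_(b in G) eg b = 1 by rewrite (sum_translate e gG).
have seg' : \sum_(b in G') eg' b = 1 by rewrite (sum_translate e' gG').
have see : \sum_(b in G) ee b = e g by rewrite (sum_delta eg) // /eg mulg1.
have see' : \sum_(b in G') ee' b = e' g'.
  by rewrite (sum_delta eg') // /eg' mulg1.
rewrite (corr g gG) (corr' g' gG') s0 s0' scg scg'.
rewrite se se' seg seg' sj sj' see see'.
have -> : ((g, g') == 1%g)%:R = e g * e' g' :> rat.
  by rewrite /e /e' -natrM mulnb.
rewrite natrX /e /e'; ring.
Qed.

End PaleyProduct.

Theorem theorem5p1 (v : nat) (gT gT' : finGroupType)
    (G : {group gT}) (G' : {group gT'}) :
  (exists D : {set gT}, is_paley_pds G D v) ->
  (exists D' : {set gT'}, is_paley_pds G' D' v) ->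
  exists E : {set gT * gT'}, is_paley_pds (setX_group G G') E (v ^ 2).
Proof.
case=> D paleyD [D' paleyD'].
by exists (paley_prod G G' D D'); apply: paley_pds_prod.
Qed.
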